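(* Let $M$ be a closed oriented smooth 3-manifold with a contact structure $\xi$, let $\alpha$ be a contact form on $M$ with $\operatorname{Ker}\alpha=\xi$, and let $J$ be an almost complex structure on $\xi$ compatible with $\alpha$. Let $g_\alpha = d\alpha(\cdot, J\cdot)+\alpha\otimes\alpha$ be the associated Webster metric on $M$, let $\nabla$ be the Levi-Civita connection of $g_\alpha$, and let $R_\alpha$ be the Reeb vector field of $\alpha$, i.e. the vector field defined by $\alpha(R_\alpha)=1$ and $d\alpha(R_\alpha,\cdot)=0$. Then $$\nabla_{R_\alpha}R_\alpha=0.$$ Thus, the integral curves of $R_\alpha$ are geodesics of $g_\alpha$.
   Context: A contact structure on a closed oriented 3-manifold $M$ is a 2-plane field $\xi\subset TM$ with $\xi=\operatorname{Ker}\alpha$ for some smooth 1-form $\alpha$ satisfying $\alpha\wedge d\alpha>0$ (a contact form for $\xi$). An almost complex structure $J$ on $\xi$ is a smooth bundle endomorphism $J:\xi\to\xi$ with $J^2=-I$. It is compatible with $\alpha$ if $d\alpha(\cdot,J\cdot)$ is a positive definite metric (in particular a symmetric bilinear form) on $\xi$. The Webster metric is the Riemannian metric $g_\alpha=d\alpha(\cdot,J\cdot)+\alpha\otimes\alpha$ on $M$, where $J$ is extended from $\xi$ to $TM=\xi\oplus\langle R_\alpha\rangle$ by $J R_\alpha=0$. Thus $g_\alpha(R_\alpha,R_\alpha)=1$, $R_\alpha$ is $g_\alpha$-orthogonal to $\xi$, and $g_\alpha$ restricts to $d\alpha(\cdot,J\cdot)$ on $\xi$. *)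

(* Defs.v *)
From HB Require Import structures.
From mathcomp Require Import all_boot all_order all_algebra.
From mathcomp Require Import all_classical all_reals all_analysis.

Set Implicit Arguments.
Unset Strict Implicit.
Unset Printing Implicit Defensive.

Import Order.TTheory GRing.Theory Num.Theory.
Import numFieldNormedType.Exports.

Local Open Scope classical_set_scope.
Local Open Scope ring_scope.

(* Meant for open [U]; the spaces below are finite-dimensional, so that the
   derivative is C^k iff all the maps [x |-> 'd f x v] are. *)
Fixpoint Ck (R : realType) (E F : normedModType R) (k : nat) (U : set E)
    (f : E -> F) : Prop :=
  match k with
  | 0%N => forall x, U x -> {for x, continuous f}
  | k'.+1 => (forall x, U x -> differentiable f x) /\
             (forall v : E, Ck k' U (fun x => 'd f x v))
  end.

Definition smooth_on (R : realType) (E F : normedModType R) (U : set E)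
    (f : E -> F) : Prop :=
  forall k, Ck k U f.

(* [cmap] is only meaningful on [cdom], and [cinv] on [cmap @` cdom]. *)
Record chart (R : realType) (M : topologicalType) := Chart {
  cdom : set M;
  cmap :> M -> 'rV[R]_3;
  cinv : 'rV[R]_3 -> M;
  cdom_open : open cdom;
  cimg_open : open (cmap @` cdom);
  cmapK : forall p, cdom p -> cinv (cmap p) = p;
  cmap_continuous : forall p, cdom p -> {for p, continuous cmap};
  cinv_continuous : forall x, (cmap @` cdom) x -> {for x, continuous cinv} }.

Record closed_oriented_3manifold (R : realType) := ClosedOriented3Manifold {
  carrier :> topologicalType;
  carrier_hausdorff : hausdorff_space carrier;
  carrier_second_countable : @second_countable carrier;
  carrier_compact : compact [set: carrier];
  atlas : set (chart R carrier);
  atlas_cover : forall p : carrier, exists2 c, atlas c & cdom c p;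
  atlas_smooth : forall c c', atlas c -> atlas c' ->
    smooth_on (c @` (cdom c `&` cdom c')) (c' \o cinv c);
  atlas_oriented : forall c c', atlas c -> atlas c' ->
    forall p, cdom c p -> cdom c' p ->
    0 < \det (jacobian (c' \o cinv c) (c p)) }.

Section Manifold.
Variables (R : realType) (M : closed_oriented_3manifold R).

Definition chart_at (p : M) : chart R M := s2val (cid2 (atlas_cover p)).

(* The tangent space T_pM is represented by 'rV[R]_3, a tangent vector being
   given by its coordinates in [chart_at p]. As [chart_at p] varies wildly
   with p, smoothness is always expressed after passing to a fixed chart c,
   through the inverse isomorphisms [coord c p : T_pM -> R^3] and
   [coord_inv c p : R^3 -> T_pM], for p in the domain of c. *)
Definition coord (c : chart R M) (p : M) (v : 'rV[R]_3) : 'rV[R]_3 :=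
  'd (c \o cinv (chart_at p)) (chart_at p p) v.

Definition coord_inv (c : chart R M) (p : M) (v : 'rV[R]_3) : 'rV[R]_3 :=
  'd (chart_at p \o cinv c) (c p) v.

Definition vfield := M -> 'rV[R]_3.

Definition form1 := M -> 'Hom('rV[R]_3, R^o).

Definition smooth_function (f : M -> R) : Prop :=
  forall c, atlas c -> smooth_on (c @` cdom c) (f \o cinv c).

Definition smooth_vfield_on (O : set M) (X : vfield) : Prop :=
  forall c, atlas c -> smooth_on (c @` (cdom c `&` O))
    ((fun q => coord c q (X q)) \o cinv c).

Definition smooth_vfield (X : vfield) : Prop := smooth_vfield_on setT X.

Definition smooth_form1 (alpha : form1) : Prop :=
  forall c, atlas c -> forall v, smooth_on (c @` cdom c)
    ((fun q => (alpha q (coord_inv c q v) : R)) \o cinv c).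

Definition fderiv (f : M -> R) (p : M) (v : 'rV[R]_3) : R :=
  'd (f \o cinv (chart_at p)) (chart_at p p) v.

(* derivative at p, in the direction v, of the coordinates of X in the fixed
   chart [chart_at p]; this depends on the chart, unlike [lie_bracket] *)
Definition vfderiv (X : vfield) (p : M) (v : 'rV[R]_3) : 'rV[R]_3 :=
  let c := chart_at p in
  'd ((fun q => coord c q (X q)) \o cinv c) (c p) v.

Definition lie_bracket (X Y : vfield) : vfield :=
  fun p => vfderiv Y p (X p) - vfderiv X p (Y p).

(* v (alpha w) - w (alpha v), where v, w are extended with constant
   coordinates in [chart_at p], so that their bracket vanishes *)
Definition ext_deriv (alpha : form1) (p : M) (v w : 'rV[R]_3) : R :=
  let c := chart_at p in
  let a (u : 'rV[R]_3) (q : M) : R := alpha q (coord_inv c q u) in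
  fderiv (a w) p v - fderiv (a v) p w.

(* (a /\ b)(u, v, w) for a 1-form a and a 2-form b *)
Definition wedge12 (a : 'rV[R]_3 -> R) (b : 'rV[R]_3 -> 'rV[R]_3 -> R)
    (u v w : 'rV[R]_3) : R :=
  a u * b v w + a v * b w u + a w * b u v.

(* The charts of the atlas are oriented, hence the canonical basis of 'rV_3 is
   a positive basis of every tangent space. *)
Definition contact_form (alpha : form1) : Prop :=
  smooth_form1 alpha /\
  forall p, 0 < wedge12 (alpha p) (ext_deriv alpha p)
    (delta_mx 0 (inord 0)) (delta_mx 0 (inord 1)) (delta_mx 0 (inord 2)).

Definition plane_field := M -> {vspace 'rV[R]_3}.

Definition contact_form_for (alpha : form1) (xi : plane_field) : Prop :=
  contact_form alpha /\ forall p, lker (alpha p) = xi p.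

Definition contact_structure (xi : plane_field) : Prop :=
  (forall p, \dim (xi p) = 2%N) /\ exists alpha, contact_form_for alpha xi.

Definition bundle_end (xi : plane_field) := forall p : M, 'End(subvs_of (xi p)).

(* J v for v in xi_p, as a tangent vector to M; if v is not in xi_p, it is
   first projected to xi_p along an unspecified complement *)
Definition bundle_app (xi : plane_field) (J : bundle_end xi) (p : M)
    (v : 'rV[R]_3) : 'rV[R]_3 :=
  vsval (J p (vsproj (xi p) v)).

Definition smooth_bundle_end (xi : plane_field) (J : bundle_end xi) : Prop :=
  forall (O : set M) (X : vfield), open O -> smooth_vfield_on O X ->
    (forall p, O p -> X p \in xi p) ->
    smooth_vfield_on O (fun p => bundle_app J p (X p)).

Definition almost_complex (xi : plane_field) (J : bundle_end xi) : Prop :=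
  smooth_bundle_end J /\ forall p u, J p (J p u) = - u.

Definition compatible (alpha : form1) (xi : plane_field) (J : bundle_end xi) :
    Prop :=
  forall p,
    (forall u v : subvs_of (xi p),
      ext_deriv alpha p (vsval u) (vsval (J p v)) =
      ext_deriv alpha p (vsval v) (vsval (J p u))) /\
    (forall u : subvs_of (xi p), u != 0 ->
      0 < ext_deriv alpha p (vsval u) (vsval (J p u))).

Definition reeb_field (alpha : form1) (X : vfield) : Prop :=
  smooth_vfield X /\
  forall p, alpha p (X p) = 1 /\ forall v, ext_deriv alpha p (X p) v = 0.

(* [v - alpha(v) R_alpha] is the component of v in xi_p, hence this is the
   extension of J with J R_alpha = 0 *)
Definition extend_end (alpha : form1) (Ra : vfield) (xi : plane_field)
    (J : bundle_end xi) (p : M) (v : 'rV[R]_3) : 'rV[R]_3 :=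
  bundle_app J p (v - (alpha p v : R) *: Ra p).

Definition webster (alpha : form1) (Ra : vfield) (xi : plane_field)
    (J : bundle_end xi) (p : M) (v w : 'rV[R]_3) : R :=
  ext_deriv alpha p v (extend_end alpha Ra J p w) +
  (alpha p v : R) * (alpha p w : R).

(* Values at non-smooth arguments are irrelevant. *)
Record connection (nabla : vfield -> vfield -> vfield) : Prop := Connection {
  connection_smooth : forall X Y, smooth_vfield X -> smooth_vfield Y ->
    smooth_vfield (nabla X Y);
  connection_linearl : forall f X X' Y, smooth_function f ->
    smooth_vfield X -> smooth_vfield X' -> smooth_vfield Y ->
    forall p, nabla (fun q => f q *: X q + X' q) Y p =
      f p *: nabla X Y p + nabla X' Y p;
  connection_addr : forall X Y Y',
    smooth_vfield X -> smooth_vfield Y -> smooth_vfield Y' ->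
    forall p, nabla X (fun q => Y q + Y' q) p = nabla X Y p + nabla X Y' p;
  connection_leibniz : forall f X Y, smooth_function f ->
    smooth_vfield X -> smooth_vfield Y ->
    forall p, nabla X (fun q => f q *: Y q) p =
      f p *: nabla X Y p + fderiv f p (X p) *: Y p }.

Definition torsion_free (nabla : vfield -> vfield -> vfield) : Prop :=
  forall X Y, smooth_vfield X -> smooth_vfield Y ->
  forall p, nabla X Y p - nabla Y X p = lie_bracket X Y p.

Definition metric_compatible (g : M -> 'rV[R]_3 -> 'rV[R]_3 -> R)
    (nabla : vfield -> vfield -> vfield) : Prop :=
  forall X Y Z, smooth_vfield X -> smooth_vfield Y -> smooth_vfield Z ->
  forall p, fderiv (fun q => g q (Y q) (Z q)) p (X p) =
    g p (nabla X Y p) (Z p) + g p (Y p) (nabla X Z p).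

Definition levi_civita (g : M -> 'rV[R]_3 -> 'rV[R]_3 -> R)
    (nabla : vfield -> vfield -> vfield) : Prop :=
  [/\ connection nabla, torsion_free nabla & metric_compatible g nabla].

(* Curves and vector fields along them are defined on an open interval I; their
   values outside I are irrelevant. *)
Definition velocity (gamma : R -> M) (t : R) : 'rV[R]_3 :=
  'D_1 (chart_at (gamma t) \o gamma) t.

Definition differentiable_curve (I : set R) (gamma : R -> M) : Prop :=
  forall t, I t -> {for t, continuous gamma} /\
    derivable (chart_at (gamma t) \o gamma) t 1.

Definition integral_curve (X : vfield) (I : set R) (gamma : R -> M) : Prop :=
  differentiable_curve I gamma /\
  forall t, I t -> velocity gamma t = X (gamma t).

Definition smooth_curve (I : set R) (gamma : R -> M) : Prop :=
  (forall t, I t -> {for t, continuous gamma}) /\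
  forall c, atlas c -> smooth_on (I `&` gamma @^-1` cdom c) (c \o gamma).

Definition smooth_along (I : set R) (gamma : R -> M) (V : R -> 'rV[R]_3) :
    Prop :=
  forall c, atlas c -> smooth_on (I `&` gamma @^-1` cdom c)
    (fun t => coord c (gamma t) (V t)).

(* D is the covariant derivative along the smooth curve gamma induced by the
   connection nabla; such an operator exists and is unique on smooth fields. *)
Record covariant_deriv_along (nabla : vfield -> vfield -> vfield)
    (I : set R) (gamma : R -> M)
    (D : (R -> 'rV[R]_3) -> (R -> 'rV[R]_3)) : Prop := CovariantDerivAlong {
  cda_smooth : forall V, smooth_along I gamma V -> smooth_along I gamma (D V);
  cda_add : forall V W, smooth_along I gamma V -> smooth_along I gamma W ->
    forall t, I t -> D (fun s => V s + W s) t = D V t + D W t;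
  cda_leibniz : forall (f : R -> R) V,
    smooth_on (I : set R) (f : R -> R) -> smooth_along I gamma V ->
    forall t, I t -> D (fun s => f s *: V s) t = 'D_1 f t *: V t + f t *: D V t;
  (* D (X o gamma) = nabla_(gamma') X, with Y extending gamma'(t) *)
  cda_extend : forall V X Y, smooth_vfield X -> smooth_vfield Y ->
    (forall t, I t -> V t = X (gamma t)) ->
    forall t, I t -> Y (gamma t) = velocity gamma t ->
    D V t = nabla Y X (gamma t) }.

Definition geodesic (nabla : vfield -> vfield -> vfield) (I : set R)
    (gamma : R -> M) : Prop :=
  smooth_curve I gamma /\
  forall D, covariant_deriv_along nabla I gamma D ->
  forall t, I t -> D (velocity gamma) t = 0.

End Manifold.

(* Main.v *)
From HB Require Import structures.
Require Import Defs.
From mathcomp Require Import all_boot all_order all_algebra.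
From mathcomp Require Import all_classical all_reals all_analysis.
From mathcomp Require Import ring lra.
Import Order.TTheory GRing.Theory Num.Theory.
Import numFieldNormedType.Exports.
Local Open Scope classical_set_scope.
Local Open Scope ring_scope.

(** Write [R] for the Reeb field, [g] for the Webster metric and
    [N := nabla_R R]. Since [R] is in the kernel of [dalpha] and [J R = 0], the
    metric satisfies [g(R, X) = alpha(X)] for every [X] ([webster_reebl],
    [webster_reebr]); in particular [g(R, R) = 1]. Metric compatibility and the
    absence of torsion give, for every smooth [X],

      [g(N, X) = R(g(R, X)) - g(R, nabla_R X)
               = R(alpha X) - g(R, [R, X]) - g(R, nabla_X R)
               = R(alpha X) - alpha [R, X] - X(g(R, R)) / 2]

    The last term vanishes, and the other two make up
    [dalpha(R, X) + X(alpha R) = 0] by Cartan's formula for [dalpha]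
    ([ext_deriv_cartan]). Applied to the globally defined field [X = N], this
    gives [g(N, N) = 0], so that no vector has to be extended to a field by
    means of a cutoff function, and [N = 0] because [g] is definite
    ([webster_definite]): a tangent vector splits as [w + a R] with [w] in the
    contact plane, and [g] takes the value [dalpha(w, J w) + a^2] on it.

    Along an integral curve [gamma] of [R], the velocity is the restriction of
    [R], so that its covariant derivative is [nabla_R R = 0]. A geodesic being
    smooth by definition, it remains to see that an integral curve, which is
    only assumed to be differentiable, is smooth: in a chart it solves
    [x' = G(x)] with [G] smooth, and one bootstraps
    ([smooth_on_integral_curve]). *)

Set Implicit Arguments.
Unset Strict Implicit.
Unset Printing Implicit Defensive.

(** * Differentials of sums, products and locally equal maps *)

Section Calculus.
Variable R : realType.
Implicit Types U V W : normedModType R.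

(** The maps in charts are composites with chart inverses, whose values are only
    controlled near a point; all changes of expression for them go through this
    locality of the differential. *)
Lemma near_eq_is_diff V W (f g df : V -> W) (x : V) :
  (\forall y \near x, f y = g y) -> is_diff x f df -> is_diff x g df.
Proof.
move=> fg [fx fdf].
have gE : g \o shift x = cst (g x) + 'd f x +o_ (0 : V) id.
  apply/eqaddoP => e e0.
  have /eqaddoP /(_ e e0) fo := diff_locally fx.
  have fg0 : \forall h \near (0 : V), f (h + x) = g (h + x).
    by move: fg; rewrite (near_shift 0) subr0; apply: filterS.
  near=> h.
  have <- : (f \o shift x - (cst (f x) + 'd f x)) h =
            (g \o shift x - (cst (g x) + 'd f x)) h.
    by rewrite /= !fctE /= (nbhs_singleton fg) (near fg0 h).
  by near: h.
have dg : 'd g x = 'd f x :> (V -> W).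
  by apply: diff_unique => //; exact: diff_continuous.
split; last by rewrite dg.
by apply/diff_locallyP; rewrite dg; split => //; exact: diff_continuous.
Unshelve. all: by end_near. Qed.

(** [is_diff_comp] with both composites in applied form, which lets unification
    work on functions that are not syntactically composites. *)
Lemma is_diff_comp_fun U V W (f df : U -> V) (g dg : V -> W) (x : U) :
  is_diff x f df -> is_diff (f x) g dg ->
  is_diff x (fun y => g (f y)) (fun u => dg (df u)).
Proof. by move=> fx gx; apply: (is_diff_comp (g := g) (dg := dg)). Qed.

Lemma is_diff_scale V W (f df : V -> R) (g dg : V -> W) (x : V) :
  is_diff x f df -> is_diff x g dg ->
  is_diff x (fun y => f y *: g y) (fun v => df v *: g x + f x *: dg v).
Proof.
move=> fx gx.
(* Scaling is a continuous bilinear map, composed here with (f, g). *)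
have sbl : bilinear_for (GRing.Scale.Law.clone _ _ *:%R _)
    (GRing.Scale.Law.clone _ _ *:%R _) (@GRing.scale R W).
  by split=> [w|r] a u v /=; rewrite ?scalerDl ?scalerDr ?scalerA // mulrC.
pose sM := @bilinear_isBilinear.Build R R W W _ _ (@GRing.scale R W) sbl.
pose s : {bilinear R -> W -> W} := HB.pack (@GRing.scale R W) sM.
have sc : continuous (fun p : R * W => s p.1 p.2).
  by move=> p; exact: scale_continuous.
have sd : is_diff (f x, g x) (fun q : R * W => s q.1 q.2)
    (fun q => s (f x) q.2 + s q.1 (g x)).
  by split; [exact: differentiable_bilin|rewrite diff_bilin].
have fgx : is_diff x (fun y => (f y, g y)) (fun v => (df v, dg v)).
  exact: is_diff_pair.
have [sfg dsfg] := is_diff_comp_fun fgx sd.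
by split => //; rewrite dsfg; apply/funext => v /=; rewrite addrC.
Qed.

Lemma is_diff_sum V W n (f df : 'I_n -> V -> W) (x : V) :
  (forall i, is_diff x (f i) (df i)) ->
  is_diff x (fun y => \sum_i f i y) (fun v => \sum_i df i v).
Proof.
move=> fx; have -> : (fun y => \sum_i f i y) = \sum_i f i.
  by apply/funext => y; rewrite fct_sumE.
have -> : (fun v => \sum_i df i v) = \sum_i df i.
  by apply/funext => v; rewrite fct_sumE.
apply: (big_ind2 (fun f df => is_diff x f df)) => //.
- exact: (is_diff_cst 0).
- by move=> f1 df1 f2 df2 h1 h2; exact: is_diffD.
Qed.

Lemma is_diff_entry n (i : 'I_n) (x : 'rV[R]_n) :
  is_diff x (fun y => y 0 i : R) (fun v => v 0 i).
Proof.
have lin : linear (fun y : 'rV[R]_n => y 0 i : R).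
  by move=> a u v; rewrite !mxE.
pose L : {linear 'rV[R]_n -> R} :=
  HB.pack (fun y : 'rV[R]_n => y 0 i : R) (GRing.isLinear.Build _ _ _ _ _ lin).
have Lc : continuous L by exact: coord_continuous.
by split; [exact: (@linear_differentiable _ _ _ L)|exact: (@diff_lin _ _ _ L)].
Qed.

Lemma is_diff_on_basis n V (f df : 'rV[R]_n -> V) (x : 'rV[R]_n) :
  is_diff x f df ->
  forall v, df v = \sum_i v 0 i *: df (delta_mx 0 i).
Proof.
move=> [_ <-] v; rewrite [in LHS](row_sum_delta v) linear_sum.
by apply: eq_bigr => i _; rewrite linearZ.
Qed.

End Calculus.

(** * Smooth maps on open sets and bootstrapping *)

Section Smoothness.
Variable R : realType.
Implicit Types V W : normedModType R.

Lemma Ck_ext V W k (U : set V) (f g : V -> W) : open U ->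
  (forall x, U x -> f x = g x) -> Ck k U f -> Ck k U g.
Proof.
move=> oU; elim: k f g => [|k IH] f g fg /=.
  move=> fc x Ux; have near_fg : \forall y \near x, f y = g y.
    by apply: filterS (open_nbhs_nbhs (conj oU Ux)) => y; exact: fg.
  rewrite /prop_for /continuous_at -fg //.
  by apply: cvg_trans (fc x Ux); apply: near_eq_cvg.
move=> [df Cdf].
have dg x : U x -> is_diff x g ('d f x).
  move=> Ux; apply: near_eq_is_diff (differentiableP (df x Ux)).
  by apply: filterS (open_nbhs_nbhs (conj oU Ux)) => y; exact: fg.
split=> [x /dg[]//|v]; apply: IH (Cdf v) => x /dg gx.
by rewrite (diff_val (is_diff_def := gx)).
Qed.

(** The induction step of the closure properties below: the predicate [Ck]
    speaks of the chosen differential, which is known only through [is_diff]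
    and only on [U]. *)
Lemma Ck_is_diff V W k (U : set V) (f : V -> W) (df : V -> V -> W) : open U ->
  (forall x, U x -> is_diff x f (df x)) ->
  (forall v, Ck k U (fun x => df x v)) -> Ck k.+1 U f.
Proof.
move=> oU fx Cdf; split=> [x /fx[]//|v].
by apply: Ck_ext (Cdf v) => // x /fx[_ ->].
Qed.

Lemma Ck_diff V W k (U : set V) (f : V -> W) x :
  Ck k.+1 U f -> U x -> is_diff x f ('d f x).
Proof. by case=> fx _ /fx /differentiableP. Qed.

Lemma Ck_diffv V W k (U : set V) (f : V -> W) v :
  Ck k.+1 U f -> Ck k U (fun x => 'd f x v).
Proof. by case=> _; apply. Qed.

Lemma Ck_pred V W k (U : set V) (f : V -> W) : Ck k.+1 U f -> Ck k U f.
Proof.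
elim: k f => [f [df _] x /df|k IH f [df Cdf]].
  exact: differentiable_continuous.
by split=> // v; apply: IH.
Qed.

Lemma Ck_cst V W k (U : set V) (w : W) : open U -> Ck k U (fun=> w).
Proof.
move=> oU; elim: k w => [w x _|k IH w]; first exact: cst_continuous.
by apply: (@Ck_is_diff _ _ _ _ _ (fun=> cst 0)).
Qed.

Lemma CkD V W k (U : set V) (f g : V -> W) : open U ->
  Ck k U f -> Ck k U g -> Ck k U (fun x => f x + g x).
Proof.
move=> oU; elim: k f g => [f g fc gc x Ux|k IH f g Cf Cg].
  exact: continuousD (fc x Ux) (gc x Ux).
apply: (@Ck_is_diff _ _ _ _ _ (fun x v => 'd f x v + 'd g x v)) => // [x Ux|v].
  exact: is_diffD (Ck_diff Cf Ux) (Ck_diff Cg Ux).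
by apply: IH; exact: Ck_diffv.
Qed.

Lemma Ck_sum V W k (U : set V) n (f : 'I_n -> V -> W) : open U ->
  (forall i, Ck k U (f i)) -> Ck k U (fun x => \sum_i f i x).
Proof.
move=> oU Cf; have -> : (fun x => \sum_i f i x) = \sum_i f i.
  by apply/funext => x; rewrite fct_sumE.
apply: (big_ind (Ck k U)) => //; first exact: (@Ck_cst _ _ _ _ 0).
by move=> g h; exact: CkD.
Qed.

Lemma Ck_scale V W k (U : set V) (f : V -> R) (g : V -> W) : open U ->
  Ck k U f -> Ck k U g -> Ck k U (fun x => f x *: g x).
Proof.
move=> oU; elim: k f g => [f g fc gc x Ux|k IH f g Cf Cg].
  exact: continuousZ (fc x Ux) (gc x Ux).
apply: (@Ck_is_diff _ _ _ _ _ (fun x v => 'd f x v *: g x + f x *: 'd g x v))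
    => // [x Ux|v].
  exact: is_diff_scale (Ck_diff Cf Ux) (Ck_diff Cg Ux).
by apply: CkD => //; apply: IH; by [exact: Ck_diffv|exact: Ck_pred].
Qed.

Lemma Ck_entry V n k (U : set V) (f : V -> 'rV[R]_n) (i : 'I_n) : open U ->
  Ck k U f -> Ck k U (fun x => f x 0 i : R).
Proof.
move=> oU; elim: k f => [f fc x Ux|k IH f Cf].
  exact: (cvg_comp _ _ (fc x Ux) (@coord_continuous _ _ _ _ _ _)).
apply: (@Ck_is_diff _ _ _ _ _ (fun x v => 'd f x v 0 i)) => // [x Ux|v].
  exact: is_diff_comp_fun (Ck_diff Cf Ux) (is_diff_entry _ _).
by apply: IH; exact: Ck_diffv.
Qed.

Lemma smooth_on_diff V W (U : set V) (f : V -> W) x :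
  smooth_on U f -> U x -> is_diff x f ('d f x).
Proof. by move=> /(_ 1%N); exact: Ck_diff. Qed.

(** [Ck] asks for the smoothness of [x |-> 'd f x v] for a fixed [v] only. For a
    direction that varies with [x], one expands it in the canonical basis, which
    is where finite dimension comes in. *)
Lemma smooth_on_deriv_along n W (U : set 'rV[R]_n) (f : 'rV[R]_n -> W)
    (G : 'rV[R]_n -> 'rV[R]_n) : open U ->
  smooth_on U f -> smooth_on U G -> smooth_on U (fun x => 'd f x (G x)).
Proof.
move=> oU sf sG k.
apply: (@Ck_ext _ _ _ _ (fun x => \sum_i G x 0 i *: 'd f x (delta_mx 0 i)))
  => // [x Ux|].
  by rewrite -(is_diff_on_basis (smooth_on_diff sf Ux)).
apply: Ck_sum => // i; apply: Ck_scale => //; first exact: Ck_entry.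
exact: Ck_diffv.
Qed.

Lemma smooth_on_id V (U : set V) : open U -> smooth_on U id.
Proof.
move=> oU [|k]; first by move=> x _; exact: cvg_id.
by apply: (@Ck_is_diff _ _ _ _ _ (fun=> id)) => // v; exact: Ck_cst.
Qed.

(** Bootstrapping. If [x' = G(x)] then [(F o x)' = (G F) o x], where the
    derivative [G F] of [F] along [G] is smooth when [F] is. Proving that [F o x]
    is C^k for all smooth [F] at once therefore makes the induction on [k] go
    through without a chain rule for higher derivatives; the case [F = id] is
    the claim. *)
Lemma smooth_on_integral_curve n (T : set R) (U : set 'rV[R]_n)
    (G : 'rV[R]_n -> 'rV[R]_n) (x : R -> 'rV[R]_n) :
  open T -> open U -> smooth_on U G -> (forall t, T t -> U (x t)) ->
  (forall t, T t -> is_diff t x (fun v => v *: G (x t))) -> smooth_on T x.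
Proof.
move=> oT oU sG TU dx k.
suff: forall F : 'rV[R]_n -> 'rV[R]_n, smooth_on U F -> Ck k T (F \o x).
  by move=> /(_ id); apply; exact: smooth_on_id.
elim: k => [|k IH] F sF.
  move=> t Tt; apply: differentiable_continuous.
  by case: (is_diff_comp_fun (dx t Tt) (smooth_on_diff sF (TU t Tt))).
apply: (@Ck_is_diff _ _ _ _ _ (fun t v => 'd F (x t) (v *: G (x t))))
    => // [t Tt|v].
  exact: is_diff_comp_fun (dx t Tt) (smooth_on_diff sF (TU t Tt)).
apply: (@Ck_ext _ _ _ _ (fun t => v *: ('d F (x t) (G (x t))))) => // [t _|].
  by rewrite linearZ.
apply: Ck_scale => //; first exact: Ck_cst.
by apply: (IH (fun y => 'd F y (G y))); exact: smooth_on_deriv_along.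
Qed.

End Smoothness.

(** * Charts, and Cartan's formula for the exterior derivative *)

Section Charts.
Variables (R : realType) (M : closed_oriented_3manifold R).
Implicit Types (c : chart R M) (p q : M) (X Y : vfield M) (alpha : form1 M).

Lemma chart_at_atlas p : atlas (chart_at p).
Proof. by rewrite /chart_at; case: cid2. Qed.

Lemma chart_at_dom p : cdom (chart_at p) p.
Proof. by rewrite /chart_at; case: cid2. Qed.

Local Hint Resolve chart_at_atlas chart_at_dom : core.

Lemma near_cinv c p (P : M -> Prop) : cdom c p ->
  (\forall q \near p, P q) -> \forall x \near c p, P (cinv c x).
Proof.
move=> cp; rewrite -{1}(cmapK cp); apply: cinv_continuous.
by exists p.
Qed.

Lemma near_cdom c p : cdom c p -> \forall q \near p, cdom c q.
Proof.
by move=> cp; exact: open_nbhs_nbhs (conj (cdom_open c) cp).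
Qed.

Lemma near_cinvK c p : cdom c p -> \forall x \near c p, c (cinv c x) = x.
Proof.
move=> cp; have : open_nbhs (c p) (c @` cdom c).
  by split; [exact: cimg_open|exists p].
by move/open_nbhs_nbhs; apply: filterS => _ [q cq <-]; rewrite cmapK.
Qed.

Lemma is_diff_transition c c' p : atlas c -> atlas c' -> cdom c p ->
  cdom c' p -> is_diff (c p) (c' \o cinv c) ('d (c' \o cinv c) (c p)).
Proof.
move=> ac ac' cp c'p; apply: smooth_on_diff (atlas_smooth ac ac') _.
by exists p.
Qed.

Lemma is_diff_transition_id c p : cdom c p -> is_diff (c p) (c \o cinv c) id.
Proof.
move=> cp; apply: (@near_eq_is_diff _ _ _ id).
by apply: filterS (near_cinvK cp) => x /= ->.
Qed.

(** The chain rule for the two transition maps between [c] and [c'], which are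
    inverse to each other near [c p]. *)
Lemma transitionK c c' p v : atlas c -> atlas c' -> cdom c p -> cdom c' p ->
  'd (c \o cinv c') (c' p) ('d (c' \o cinv c) (c p) v) = v.
Proof.
move=> ac ac' cp c'p.
have dc := is_diff_transition ac ac' cp c'p.
have dc' : is_diff ((c' \o cinv c) (c p)) (c \o cinv c')
    ('d (c \o cinv c') (c' p)).
  have -> : (c' \o cinv c) (c p) = c' p by rewrite /comp cmapK.
  exact: is_diff_transition.
have [_ dcc'] := is_diff_comp_fun dc dc'.
have [_ did] : is_diff (c p) (fun y => (c \o cinv c') ((c' \o cinv c) y)) id.
  apply: near_eq_is_diff (is_diff_transition_id cp).
  apply: filterS (near_cinv cp (near_cdom c'p)) => x xc'.
  by rewrite /comp (cmapK xc').
exact: etrans (esym (congr1 (@^~ v) dcc')) (congr1 (@^~ v) did).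
Qed.

Lemma coordK c p v : atlas c -> cdom c p ->
  coord_inv c p (Defs.coord c p v) = v.
Proof. by move=> ac cp; exact: transitionK. Qed.

Lemma coord_chart_at p v : Defs.coord (chart_at p) p v = v.
Proof.
by rewrite /Defs.coord (diff_val (is_diff_def := is_diff_transition_id _)).
Qed.

Lemma coord_inv_chart_at p v : coord_inv (chart_at p) p v = v.
Proof. exact: coord_chart_at. Qed.

Lemma is_diff_vfield X p : smooth_vfield X ->
  is_diff (chart_at p p)
    ((fun q => Defs.coord (chart_at p) q (X q)) \o cinv (chart_at p))
    (vfderiv X p).
Proof.
move=> /(_ _ (chart_at_atlas p)) sX; apply: smooth_on_diff sX _.
by exists p.
Qed.

Lemma is_diff_form1 alpha p v : smooth_form1 alpha ->
  is_diff (chart_at p p)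
    ((fun q => alpha q (coord_inv (chart_at p) q v) : R) \o cinv (chart_at p))
    (fderiv (fun q => alpha q (coord_inv (chart_at p) q v)) p).
Proof.
move=> /(_ _ (chart_at_atlas p) v) sa; apply: smooth_on_diff sa _.
by exists p.
Qed.

Lemma fderiv_cst (r : R) p v : fderiv (fun=> r : R) p v = 0.
Proof. by rewrite /fderiv (diff_cst r). Qed.

(** The component of [alpha] along the constant direction [w] is linear in [w],
    and its directional derivatives inherit this; smoothness of [alpha] is what
    allows one to differentiate the sum termwise. *)
Lemma fderiv_form1_basis alpha p v w : smooth_form1 alpha ->
  fderiv (fun q => alpha q (coord_inv (chart_at p) q w)) p v =
  \sum_i w 0 i *
    fderiv (fun q => alpha q (coord_inv (chart_at p) q (delta_mx 0 i))) p v.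
Proof.
move=> sa; pose a i := (fun q => alpha q
  (coord_inv (chart_at p) q (delta_mx 0 i)) : R) \o cinv (chart_at p).
have da i : is_diff (chart_at p p) (fun x => w 0 i *: a i x)
    (fun v => w 0 i *: 'd (a i) (chart_at p p) v).
  by apply: is_diffZ; exact: is_diff_form1.
have [_ daE] := is_diff_sum da.
apply: etrans (congr1 (@^~ v) daE).
rewrite /fderiv; congr ('d _ _ _); apply/funext => x.
rewrite /a /comp.
rewrite {1}(row_sum_delta w) /coord_inv !linear_sum.
by apply: eq_bigr => i _; rewrite !linearZ.
Qed.

(** The Leibniz rule for the pairing of [alpha] and [Y], in the coordinates of
    the chart chosen at [p]: first differentiate the coefficients of [alpha],
    [Y] keeping its coordinates at [p], then those of [Y]. Both terms depend on
    the chart. *)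
Lemma fderiv_form1_vfield alpha Y p v : smooth_form1 alpha ->
  smooth_vfield Y ->
  fderiv (fun q => alpha q (Y q)) p v =
  fderiv (fun q => alpha q (coord_inv (chart_at p) q (Y p))) p v +
  alpha p (vfderiv Y p v).
Proof.
move=> sa sY; set c := chart_at p.
(* Near c p, alpha(Y) is the sum of the y_i a_i: inserting coord_inv o coord,
   the identity, makes the coordinates of Y in the fixed chart c appear. *)
pose a i := (fun q => alpha q (coord_inv c q (delta_mx 0 i)) : R) \o cinv c.
pose y i := fun x => ((fun q => Defs.coord c q (Y q)) \o cinv c) x 0 i.
have day i : is_diff (c p) (fun x => y i x *: a i x)
    (fun v => vfderiv Y p v 0 i *: a i (c p) + y i (c p) *: 'd (a i) (c p) v).
  apply: is_diff_scale; last exact: is_diff_form1.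
  exact: is_diff_comp_fun (is_diff_vfield p sY) (is_diff_entry _ _).
have [_ dayE] : is_diff (c p) ((fun q => alpha q (Y q) : R) \o cinv c)
    (fun v => \sum_i (vfderiv Y p v 0 i *: a i (c p) +
                      y i (c p) *: 'd (a i) (c p) v)).
  apply: near_eq_is_diff (is_diff_sum day).
  apply: filterS (near_cinv (chart_at_dom p) (near_cdom (chart_at_dom p))).
  move=> x xc /=; rewrite -[in RHS](coordK (Y (cinv c x)) (chart_at_atlas p) xc).
  rewrite [Defs.coord _ _ _ in RHS]row_sum_delta /coord_inv !linear_sum.
  by apply: eq_bigr => i _; rewrite !linearZ.
apply: etrans (congr1 (@^~ v) dayE) _.
rewrite big_split [RHS]addrC; congr (_ + _).
  rewrite [in RHS](row_sum_delta (vfderiv Y p v)) linear_sum.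
  apply: eq_bigr => i _.
  by rewrite linearZ /a /comp /c cmapK // coord_inv_chart_at.
rewrite /c fderiv_form1_basis //.
apply: eq_bigr => i _.
by rewrite /y /comp /c cmapK // coord_chart_at.
Qed.

(** Cartan's formula: the derivatives of the coordinates of [X] and [Y] in the
    two Leibniz rules add up to the value of [alpha] on the bracket, and what
    remains is [dalpha] as defined on fields with constant coordinates. *)
Lemma ext_deriv_cartan alpha X Y p : smooth_form1 alpha ->
  smooth_vfield X -> smooth_vfield Y ->
  ext_deriv alpha p (X p) (Y p) =
  fderiv (fun q => alpha q (Y q)) p (X p) -
  fderiv (fun q => alpha q (X q)) p (Y p) -
  alpha p (lie_bracket X Y p).
Proof.
move=> sa sX sY; rewrite (fderiv_form1_vfield _ _ sa sX).
rewrite (fderiv_form1_vfield _ _ sa sY) /lie_bracket linearB /ext_deriv.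
ring.
Qed.

Lemma ext_deriv_antisym alpha p v w :
  ext_deriv alpha p w v = - ext_deriv alpha p v w.
Proof. by rewrite /ext_deriv opprB. Qed.

Lemma ext_deriv_linearr alpha p v (k : R) w w' : smooth_form1 alpha ->
  ext_deriv alpha p v (k *: w + w') =
  k * ext_deriv alpha p v w + ext_deriv alpha p v w'.
Proof.
move=> sa; have fderivP u : fderiv (fun q => alpha q
    (coord_inv (chart_at p) q (k *: w + w'))) p u =
  k * fderiv (fun q => alpha q (coord_inv (chart_at p) q w)) p u +
  fderiv (fun q => alpha q (coord_inv (chart_at p) q w')) p u.
  rewrite !(@fderiv_form1_basis _ _ u) // mulr_sumr -big_split /=.
  by apply: eq_bigr => i _; rewrite !mxE; ring.
have fderivZD f : fderiv f p (k *: w + w') = k * fderiv f p w + fderiv f p w'.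
  exact: linearP.
by rewrite /ext_deriv fderivP fderivZD opprD addrACA mulrBr.
Qed.

Lemma ext_deriv0r alpha p v : smooth_form1 alpha -> ext_deriv alpha p v 0 = 0.
Proof.
move=> sa; have := ext_deriv_linearr p v 1 0 0 sa.
rewrite scale1r addr0 mul1r => /(canLR (addrK _)) <-.
exact: subrr.
Qed.

End Charts.

(** * The Reeb field and the Webster metric *)

Section Webster.
Variables (R : realType) (M : closed_oriented_3manifold R).
Variables (xi : plane_field M) (alpha : form1 M) (J : bundle_end xi).
Variable Ra : vfield M.
Hypothesis halpha : contact_form_for alpha xi.
Hypothesis hJ : compatible alpha J.
Hypothesis hRa : reeb_field alpha Ra.
Implicit Types (p : M) (v w : 'rV[R]_3).

Let sa : smooth_form1 alpha.
Proof. by case: halpha => -[]. Qed.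

Let alphaRa p : alpha p (Ra p) = 1.
Proof. by case: hRa => _ /(_ p)[]. Qed.

Let dalphaRa p v : ext_deriv alpha p (Ra p) v = 0.
Proof. by case: hRa => _ /(_ p)[]. Qed.

Lemma webster_reebl p w : webster alpha Ra J p (Ra p) w = alpha p w.
Proof. by rewrite /webster dalphaRa alphaRa add0r mul1r. Qed.

Lemma webster_reebr p v : webster alpha Ra J p v (Ra p) = alpha p v.
Proof.
rewrite /webster /extend_end alphaRa scale1r subrr /bundle_app !linear0 mulr1.
by rewrite ext_deriv0r // add0r.
Qed.

(** With [v = w + a R] and [w] in the contact plane, [g(v, v)] is
    [dalpha(w, J w) + a^2], since the contribution of [R] to [dalpha(v, J w)]
    vanishes. *)
Lemma webster_definite p v : webster alpha Ra J p v v = 0 -> v = 0.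
Proof.
set a := alpha p v : R; pose w := v - a *: Ra p.
have wxi : w \in xi p.
  by case: halpha => _ <-; rewrite memv_ker linearB linearZ /= alphaRa
    [_ *: _]mulr1 subrr.
pose u := vsproj (xi p) w.
have uw : vsval u = w by exact: vsprojK.
have -> : webster alpha Ra J p v v =
    ext_deriv alpha p (vsval u) (vsval (J p u)) + a ^+ 2.
  rewrite /webster /extend_end -/a -/w /bundle_app -/u uw -expr2.
  congr (_ + _); set z := vsval _.
  rewrite (ext_deriv_antisym alpha p z v) (ext_deriv_antisym alpha p z w).
  have -> : v = a *: Ra p + w by rewrite addrC subrK.
  rewrite ext_deriv_linearr // (ext_deriv_antisym alpha p (Ra p) z) dalphaRa.
  by rewrite oppr0 mulr0 add0r.
have [u0|u0] := eqVneq u 0.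
  rewrite u0 !linear0 ext_deriv0r // add0r => /eqP; rewrite sqrf_eq0 => /eqP a0.
  by rewrite -[v](subrK (a *: Ra p)) -/w -uw u0 a0 scale0r linear0 addr0.
by move=> guu; have := ltr_wpDr (sqr_ge0 a) ((hJ p).2 u u0); rewrite guu ltxx.
Qed.

(** Metric compatibility is used twice: for [R(g(R, N))], and for [N(g(R, R))],
    which gives [alpha(nabla_N R) = 0]. *)
Lemma reeb_geodesic_field nabla : levi_civita (webster alpha Ra J) nabla ->
  forall p, nabla Ra Ra p = 0.
Proof.
move=> [nablaP tf mc] p; have sR : smooth_vfield Ra by case: hRa.
pose N := nabla Ra Ra; have sN : smooth_vfield N.
  exact: (connection_smooth nablaP).
apply: (@webster_definite p).
have dRR v : fderiv (fun q => alpha q (Ra q)) p v = 0.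
  have -> : (fun q => alpha q (Ra q) : R) = fun=> 1 by apply/funext.
  exact: fderiv_cst.
have alphaNR : alpha p (nabla N Ra p) = 0.
  have := mc _ _ _ sN sR sR p; rewrite webster_reebl webster_reebr.
  have -> : (fun q => webster alpha Ra J q (Ra q) (Ra q)) =
      (fun q => alpha q (Ra q)) by apply/funext => q; rewrite webster_reebl.
  by rewrite dRR; lra.
have alphaRN : alpha p (nabla Ra N p) = alpha p (lie_bracket Ra N p).
  by rewrite -(tf _ _ sR sN) linearB /= alphaNR subr0.
have := mc _ _ _ sR sR sN p; rewrite webster_reebl alphaRN.
have -> : (fun q => webster alpha Ra J q (Ra q) (N q)) =
    (fun q => alpha q (N q)) by apply/funext => q; rewrite webster_reebl.
have := ext_deriv_cartan p sa sR sN; rewrite dalphaRa dRR -/N.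
by lra.
Qed.

End Webster.

(** * Smoothness of integral curves *)

Section IntegralCurves.
Variables (R : realType) (M : closed_oriented_3manifold R).

(** The velocity of [gamma] is expressed in a chart that changes with the time
    [t]; the chain rule carries the differential equation over to the fixed
    chart [c]. *)
Lemma integral_curve_chart (X : vfield M) (I : set R) (gamma : R -> M)
    (c : chart R M) (t : R) :
  integral_curve X I gamma -> atlas c -> I t -> cdom c (gamma t) ->
  is_diff t (c \o gamma) (fun s => s *: Defs.coord c (gamma t) (X (gamma t))).
Proof.
move=> [dg vg] ac It ct; have [cg dgt] := dg t It.
set c0 := chart_at (gamma t) in dgt *.
have d0 : is_diff t (c0 \o gamma) (fun s => s *: X (gamma t)).
  have /derivable1_diffP d := dgt; split=> //; apply/funext => s.
  rewrite -[s in LHS]mulr1 -[s * 1]/(s *: 1) linearZ; congr (_ *: _).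
  by rewrite -deriveE // -vg.
have d1 := is_diff_transition (chart_at_atlas (gamma t)) ac
  (chart_at_dom (gamma t)) ct.
have d2 := is_diff_comp_fun d0 d1.
have [dc dcE] : is_diff t (c \o gamma) (fun s =>
    'd (c \o cinv c0) (c0 (gamma t)) (s *: X (gamma t))).
  apply: near_eq_is_diff d2.
  have near_c0 : \forall s \near t, cdom c0 (gamma s).
    exact: cg (near_cdom (chart_at_dom (gamma t))).
  apply: filterS near_c0 => s cs.
  by rewrite /comp cmapK.
by split=> //; rewrite dcE; apply/funext => s; rewrite linearZ.
Qed.

Lemma integral_curve_smooth (X : vfield M) (I : set R) (gamma : R -> M) :
  open I -> smooth_vfield X -> integral_curve X I gamma ->
  smooth_curve I gamma.
Proof.
move=> oI sX gX; have cg t : I t -> {for t, continuous gamma}.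
  by move=> It; case: gX => /(_ t It)[].
split=> // c ac.
apply: (@smooth_on_integral_curve _ _ _ (c @` cdom c)
  ((fun q => Defs.coord c q (X q)) \o cinv c)).
- rewrite openE => t [It ct]; apply: filterI.
    exact: open_nbhs_nbhs (conj oI It).
  exact: cg It _ (near_cdom ct).
- exact: cimg_open.
- by have := sX c ac; rewrite setIT.
- by move=> t [_ ct]; exists (gamma t).
- move=> t [It ct]; rewrite /comp cmapK //.
  exact: integral_curve_chart gX ac It ct.
Qed.

End IntegralCurves.

Unset Implicit Arguments.

Theorem theorem4p1 (R : realType) (M : closed_oriented_3manifold R)
    (xi : plane_field M) (hxi : contact_structure xi)
    (alpha : form1 M) (halpha : contact_form_for alpha xi)
    (J : bundle_end xi) (hJ : almost_complex J) (hJalpha : compatible alpha J)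
    (Ra : vfield M) (hRa : reeb_field alpha Ra)
    (nabla : vfield M -> vfield M -> vfield M)
    (hnabla : levi_civita (webster alpha Ra J) nabla) :
  (forall p : M, nabla Ra Ra p = 0) /\
  (forall (I : set R) (gamma : R -> M), open I -> is_interval I ->
     integral_curve Ra I gamma -> geodesic nabla I gamma).
Proof.
have nablaRR := reeb_geodesic_field halpha hJalpha hRa hnabla.
split=> // I gamma oI _ gR; have [sR _] := hRa.
split; first exact: integral_curve_smooth oI sR gR.
move=> D hD t It; rewrite -[RHS](nablaRR (gamma t)).
have [_ vg] := gR.
by apply: (cda_extend hD) => //; rewrite vg.
Qed.
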